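(* For every pair of integers $k,n$ with $k>1$ and $n>3$, there is a planar lattice $L$ with the following two properties: (i) $L$ has exactly $n$ atoms and $L$ is generated by them; (ii) $L$ has more than $k$ elements.
   Context: A planar lattice is a finite lattice that has a planar (Hasse) diagram. Combinatorially, a finite lattice $L$ is planar if and only if there is a strict partial order $\lambda$ on $L$ such that any two distinct elements of $L$ are comparable with respect to exactly one of $\leq$ and $\lambda$. ''Generated by its atoms'' means that the smallest subset of $L$ containing all atoms and closed under binary joins and meets is $L$ itself. *)

(* Defs.v *)
From HB Require Import structures.
From mathcomp Require Import all_boot all_order all_algebra.
From mathcomp Require Import reals.

Set Implicit Arguments.
Unset Strict Implicit.
Unset Printing Implicit Defensive.

Import Order.TTheory GRing.Theory Num.Theory.

Definition covers (d : Order.disp_t) (L : finPOrderType d) (x y : L) : bool :=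
  (x < y)%O && [forall z : L, ~~ ((x < z)%O && (z < y)%O)].

Definition atoms (d : Order.disp_t) (L : finTBLatticeType d) : {set L} :=
  [set x : L | covers \bot%O x].

Definition meet_join_closed (d : Order.disp_t) (L : finTBLatticeType d)
    (S : {set L}) : bool :=
  [forall x in S, forall y in S,
    ((x `&` y)%O \in S) && ((x `|` y)%O \in S)].

(* The smallest subset containing A and closed under binary meets and joins;
   \bot and \top are not included as constants. *)
Definition generated (d : Order.disp_t) (L : finTBLatticeType d)
    (A : {set L}) : {set L} :=
  \bigcap_(S : {set L} | (A \subset S) && meet_join_closed S) S.

Local Open Scope ring_scope.

Definition on_segment (R : realType) (a b p : R * R) : Prop :=
  exists t : R, [/\ 0 <= t, t <= 1 &
    p = ((1 - t) * a.1 + t * b.1, (1 - t) * a.2 + t * b.2)].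

(* A Hasse diagram: pos places the elements at distinct points of the plane,
   each covering pair x -< y is drawn as the straight segment from pos x to
   pos y, which goes upwards (in the second coordinate) and passes through no
   vertex other than its endpoints. *)
Definition hasse_diagram (R : realType) (d : Order.disp_t)
    (L : finPOrderType d) (pos : L -> R * R) : Prop :=
  [/\ injective pos,
      forall x y : L, covers x y -> (pos x).2 < (pos y).2 &
      forall x y z : L, covers x y -> on_segment (pos x) (pos y) (pos z) ->
        z = x \/ z = y].

(* Two distinct edges meet at most in the position of a common endpoint. *)
Definition planar_diagram (R : realType) (d : Order.disp_t)
    (L : finPOrderType d) (pos : L -> R * R) : Prop :=
  hasse_diagram pos /\
  forall (x y z w : L) (p : R * R),
    covers x y -> covers z w -> (x, y) <> (z, w) ->
    on_segment (pos x) (pos y) p -> on_segment (pos z) (pos w) p ->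
    exists v : L, [/\ p = pos v, v = x \/ v = y & v = z \/ v = w].

Definition planar (R : realType) (d : Order.disp_t) (L : finPOrderType d) :
    Prop :=
  exists pos : L -> R * R, planar_diagram pos.

(* Main.v *)
(* A finite lattice with an order embedding (u, v) into the plane ordered
   componentwise has a planar diagram: place x at (u x - v x, u x + v x).  If the
   edges x -< y and z -< w meet, then x and z both lie below y and w.  When x and z
   are incomparable, this forces y = x v z = w; when x < z it forces z = y, and when
   z < x it forces x = w.  So the edges share an endpoint, and if they also met
   elsewhere they would lie on one ray, making their other endpoints comparable.

   The lattice is a tower of stacked diamonds with two chains beside it,

     a_0, b_k < b_N,   c_k, d < c_N,   b_0 = F_0,   c_0 = G_0,
     b_k < F_k,   c_k < G_k,   F_k, G_k < H_(k+1) < F_(k+1), G_(k+1),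

   with H_(N+1) the top.  From the atoms one gets b_N = a_0 v b_0 and c_N = c_0 v d
   and then descends by F_k = b_k v c_0, G_k = c_k v b_0, b_(k-1) = G_k ^ b_N and
   c_(k-1) = F_k ^ c_N; finally H_(k+1) = b_k v c_k.  The height N is arbitrary,
   and further atoms a_1, ..., a_m are added between the bottom and the top. *)

Require Import Defs.
From HB Require Import structures.
From mathcomp Require Import all_boot all_order all_algebra.
From mathcomp Require Import reals.
From mathcomp Require Import ring lra zify.

Set Implicit Arguments.
Unset Strict Implicit.
Unset Printing Implicit Defensive.

Import Order.TTheory GRing.Theory Num.Theory.

Lemma covers_lt (d : Order.disp_t) (L : finPOrderType d) (x y : L) :
  covers x y -> (x < y)%O.
Proof. by case/andP. Qed.

Lemma covers_between (d : Order.disp_t) (L : finPOrderType d) (x y z : L) :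
  covers x y -> (x <= z <= y)%O -> z = x \/ z = y.
Proof.
case/andP=> _ /forallP/(_ z) + /andP[].
rewrite !le_eqVlt => + /orP[/eqP-> _|xz /orP[/eqP->|zy]]; [by left|by right|].
by rewrite xz zy.
Qed.

(** * Planar diagrams from order embeddings into the plane *)

Section PlanarEmbedding.
Local Open Scope order_scope.
Local Open Scope ring_scope.
Variables (R : realType) (d : Order.disp_t) (L : finLatticeType d).
Variables u v : L -> R.
Hypothesis leE : forall x y : L, (x <= y)%O = (u x <= u y) && (v x <= v y).

Let pos (x : L) : R * R := (u x - v x, u x + v x).

Let uv_inj x y : u x = u y -> v x = v y -> x = y.
Proof. by move=> eu ev; apply/le_anti; rewrite !leE eu ev !lexx. Qed.

(** The sum and difference of the coordinates of [p] undo the rotation in [pos], up to a factor 2,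
    so segments can be studied in the (u, v) plane. *)
Let segmentE x y p : on_segment (pos x) (pos y) p ->
  exists t, [/\ 0 <= t, t <= 1, p.1 + p.2 = ((1 - t) * u x + t * u y) *+ 2 &
    p.2 - p.1 = ((1 - t) * v x + t * v y) *+ 2].
Proof. by case=> t [t0 t1 ->]; exists t; split=> //=; ring. Qed.

Let posE x (p : R * R) : p.1 + p.2 = u x *+ 2 -> p.2 - p.1 = v x *+ 2 -> p = pos x.
Proof.
by case: p => p q /= e1 e2; congr (_, _); move: e1 e2; rewrite !mulr2n; lra.
Qed.

Let segment_box x y p : (x <= y)%O -> on_segment (pos x) (pos y) p ->
  u x *+ 2 <= p.1 + p.2 <= u y *+ 2 /\ v x *+ 2 <= p.2 - p.1 <= v y *+ 2.
Proof.
rewrite leE => /andP[ux vx] /segmentE[t [t0 t1 -> ->]].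
by rewrite !lerMn2r /=; split; nra.
Qed.

(** Each segment stays in the box spanned by its ends, so [p] is above [x] and below [w] in both
    coordinates. *)
Let segments_cross x y z w p : (x <= y)%O -> (z <= w)%O ->
  on_segment (pos x) (pos y) p -> on_segment (pos z) (pos w) p -> (x <= w)%O.
Proof.
move=> xy zw /(segment_box xy)[/andP[a _] /andP[b _]].
move=> /(segment_box zw)[/andP[_ a'] /andP[_ b']].
have := le_trans a a'; have := le_trans b b'; rewrite !lerMn2r /= leE => -> ->.
by [].
Qed.

(* Two segments issuing from one vertex that meet again lie on the same ray. *)
Let same_source x y w p : (x <= y)%O -> (x <= w)%O ->
  on_segment (pos x) (pos y) p -> on_segment (pos x) (pos w) p ->
  p = pos x \/ (y >=< w)%O.
Proof.
rewrite !leE => /andP[xyu xyv] /andP[xwu xwv].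
move=> /segmentE[t [t0 _ pu pv]] /segmentE[s [s0 _ pu' pv']].
have [t00|t_neq0] := eqVneq t 0.
  by left; apply: posE; rewrite ?pu ?pv t00; ring.
have tp : 0 < t by rewrite lt_neqAle eq_sym t_neq0.
have [s00|s_neq0] := eqVneq s 0.
  by left; apply: posE; rewrite ?pu' ?pv' s00; ring.
have sp : 0 < s by rewrite lt_neqAle eq_sym s_neq0.
have eu : t * (u y - u x) = s * (u w - u x) by move: pu pu'; rewrite !mulr2n; lra.
have ev : t * (v y - v x) = s * (v w - v x) by move: pv pv'; rewrite !mulr2n; lra.
right; rewrite /Order.comparable !leE; apply/orP.
(* The smaller parameter belongs to the longer vector: [t <= s] gives [w <= y]. *)
have [ts|/ltW st] := leP t s; [right|left]; apply/andP; split.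
all: by rewrite -subr_ge0; nra.
Qed.

(** Order dual of [same_source]: here [1 - t] and [1 - s] measure the way back from the common upper
    end. *)
Let same_target x y z p : (x <= y)%O -> (z <= y)%O ->
  on_segment (pos x) (pos y) p -> on_segment (pos z) (pos y) p ->
  p = pos y \/ (x >=< z)%O.
Proof.
rewrite !leE => /andP[xyu xyv] /andP[zyu zyv].
move=> /segmentE[t [_ t1 pu pv]] /segmentE[s [_ s1 pu' pv']].
have [t11|t_neq1] := eqVneq t 1.
  by left; apply: posE; rewrite ?pu ?pv t11; ring.
have tp : t < 1 by rewrite lt_neqAle t_neq1.
have [s11|s_neq1] := eqVneq s 1.
  by left; apply: posE; rewrite ?pu' ?pv' s11; ring.
have sp : s < 1 by rewrite lt_neqAle s_neq1.
have eu : (1 - t) * (u y - u x) = (1 - s) * (u y - u z).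
  by move: pu pu'; rewrite !mulr2n; lra.
have ev : (1 - t) * (v y - v x) = (1 - s) * (v y - v z).
  by move: pv pv'; rewrite !mulr2n; lra.
right; rewrite /Order.comparable !leE; apply/orP.
have [ts|/ltW st] := leP t s; [right|left]; apply/andP; split.
all: by rewrite -subr_ge0; nra.
Qed.

Let covers_comparable_top (x y w : L) :
  covers x y -> covers x w -> (y >=< w)%O -> y = w.
Proof.
move=> xy xw /orP[yw|wy].
- have [] := covers_between (z := y) xw; rewrite ?yw ?ltW ?covers_lt// => e.
  by have := covers_lt xy; rewrite e ltxx.
- have [] := covers_between (z := w) xy; rewrite ?wy ?ltW ?covers_lt// => e.
  by have := covers_lt xw; rewrite e ltxx.
Qed.

Let covers_comparable_bottom (x y z : L) :
  covers x y -> covers z y -> (x >=< z)%O -> x = z.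
Proof.
move=> xy zy /orP[xz|zx].
- have [] := covers_between (z := z) xy; rewrite ?xz ?ltW ?covers_lt// => e.
  by have := covers_lt zy; rewrite e ltxx.
- have [] := covers_between (z := x) zy; rewrite ?zx ?ltW ?covers_lt// => e.
  by have := covers_lt xy; rewrite e ltxx.
Qed.

(** The box below [y] and the box above [y] meet only in [y]. *)
Let stacked (x y w : L) p : (x <= y)%O -> (y <= w)%O ->
  on_segment (pos x) (pos y) p -> on_segment (pos y) (pos w) p -> p = pos y.
Proof.
move=> xy yw /(segment_box xy)[/andP[_ a] /andP[_ b]].
move=> /(segment_box yw)[/andP[a' _] /andP[b' _]].
by apply: posE; apply/le_anti/andP.
Qed.

Lemma planar_of_embedding : planar R L.
Proof.
exists pos; split; first split.
- move=> x y [e1 e2]; apply: uv_inj; lra.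
- move=> x y /covers_lt xy /=; rewrite lt_neqAle; have := ltW xy.
  rewrite leE => /andP[ux vx]; rewrite lerD// andbT; apply/negP => /eqP e.
  by move: xy; rewrite (uv_inj (x := x) (y := y)) ?ltxx//; lra.
- move=> x y z xy pz; apply: (covers_between xy).
  have /(segment_box (ltW (covers_lt xy))) := pz; rewrite /pos /=.
  rewrite !leE => -[/andP[a b] /andP[a' b']].
  move: a b a' b'; rewrite !mulr2n => *.
  by apply/andP; split; apply/andP; split; lra.
- move=> x y z w p xy zw ne pxy pzw.
  have lxy := ltW (covers_lt xy); have lzw := ltW (covers_lt zw).
  have xw : (x <= w)%O := segments_cross lxy lzw pxy pzw.
  have zy : (z <= y)%O := segments_cross lzw lxy pzw pxy.
  have [xz|xz] := boolP (x >=< z)%O; last first.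
    (* The join lies in both covering intervals. Being neither [x] nor [z], it equals [y] and [w],
       and the edges have a common target. *)
    have [eyw|eyw] : x `|` z = x \/ x `|` z = y.
    + by apply: (covers_between xy); rewrite leUl leUx lxy zy.
    + by move: xz; rewrite /Order.comparable -eyw leUr orbT.
    have [ezw|ezw] : x `|` z = z \/ x `|` z = w.
    + by apply: (covers_between zw); rewrite leUr leUx lzw xw.
    + by move: xz; rewrite /Order.comparable -ezw leUl.
    move: ezw zw pzw lzw; rewrite eyw => <- _ pzw lzw.
    have [->|] := same_target lxy zy pxy pzw; last by rewrite (negPf xz).
    by exists y; split; [|right|right].
  have [exz|xz_neq] := eqVneq x z.
    subst z; have [->|c] := same_source lxy xw pxy pzw.
      by exists x; split; [|left|left].
    by case: ne; rewrite (covers_comparable_top xy zw c).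
  case/orP: xz => [xz|zx].
    have [e|e] := covers_between xy (z := z) ltac:(by rewrite xz zy).
      by rewrite e eqxx in xz_neq.
    subst z; exists y; split; [exact: stacked pxy pzw|by right|by left].
  have [e|e] := covers_between zw (z := x) ltac:(by rewrite zx xw).
    by rewrite e eqxx in xz_neq.
  subst w; exists x; split; [exact: stacked pzw pxy|by left|by right].
Qed.
End PlanarEmbedding.

(** * Coordinates of the tower *)

Section Tower.
Variables m N : nat.
Local Notation W := (m + 3 * N + 3).

(** The pairs are to be ordered componentwise. The left atoms lie on an antidiagonal, hence form an
    antichain; the b_k fill column [m + 1] and the c_k row 1; F_k and G_k lie on either side of the
    line u = v + m that carries the H_k. *)
Definition vertices : seq (nat * nat) :=
  [:: (0, 0); (W, W); (m + 3 * N + 2, 0)] ++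
  [seq (j, m + 3 * N + 2 - j) | j <- iota 0 m.+1] ++
  [seq (m + 1, 3 * k + 2) | k <- iota 0 N.+1] ++
  [seq (m + 3 * k + 2, 1) | k <- iota 0 N.+1] ++
  [seq (m + 3 * k + 1, 3 * k + 2) | k <- iota 0 N.+1] ++
  [seq (m + 3 * k + 2, 3 * k + 1) | k <- iota 0 N.+1] ++
  [seq (m + 3 * k, 3 * k) | k <- iota 1 N].

(* With j = m - i, [VLeftAtom j] is a_i; the elements b_k, c_k, F_k, G_k, H_k are
   those of the constructors [VB], ..., [VH]. *)
Variant vertex : nat -> nat -> Prop :=
  | VBot : vertex 0 0
  | VTop : vertex W W
  | VRightAtom : vertex (m + 3 * N + 2) 0
  | VLeftAtom j of j <= m : vertex j (m + 3 * N + 2 - j)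
  | VB k of k <= N : vertex (m + 1) (3 * k + 2)
  | VC k of k <= N : vertex (m + 3 * k + 2) 1
  | VF k of k <= N : vertex (m + 3 * k + 1) (3 * k + 2)
  | VG k of k <= N : vertex (m + 3 * k + 2) (3 * k + 1)
  | VH k of 0 < k <= N : vertex (m + 3 * k) (3 * k).

Lemma vertexP u v : reflect (vertex u v) ((u, v) \in vertices).
Proof.
rewrite !mem_cat; apply: (iffP idP).
  case/orP.
    rewrite !inE => /or3P[] /eqP[-> ->];
      [exact: VBot|exact: VTop|exact: VRightAtom].
  by move=> /orP[|/orP[|/orP[|/orP[|/orP[|]]]]] /mapP[k + [-> ->]];
    rewrite mem_iota => ?;
    [apply: VLeftAtom|apply: VB|apply: VC|apply: VF|apply: VG|apply: VH]; lia.
case=> [|||k ?|k ?|k ?|k ?|k ?|k ?].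
1-3: by apply/orP; left; rewrite !inE eqxx ?orbT.
- apply/orP; right; apply/orP; left.
  by apply/mapP; exists k; rewrite ?mem_iota //; lia.
- do 2 (apply/orP; right); apply/orP; left.
  by apply/mapP; exists k; rewrite ?mem_iota //; lia.
- do 3 (apply/orP; right); apply/orP; left.
  by apply/mapP; exists k; rewrite ?mem_iota //; lia.
- do 4 (apply/orP; right); apply/orP; left.
  by apply/mapP; exists k; rewrite ?mem_iota //; lia.
- do 5 (apply/orP; right); apply/orP; left.
  by apply/mapP; exists k; rewrite ?mem_iota //; lia.
- do 6 (apply/orP; right).
  by apply/mapP; exists k; rewrite ?mem_iota //; lia.
Qed.

(** * Order and lattice structure of the tower *)

Definition tower := seq_sub vertices.

HB.instance Definition _ := Finite.on tower.

Definition abs (x : tower) : nat := (val x).1.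
Definition ord (x : tower) : nat := (val x).2.

Lemma towerP (x : tower) : vertex (abs x) (ord x).
Proof. by apply/vertexP; rewrite -surjective_pairing; apply: valP. Qed.

Lemma tower_inj (x y : tower) : abs x = abs y -> ord x = ord y -> x = y.
Proof.
move=> e1 e2; apply: val_inj; apply/eqP; rewrite -pair_eqE.
by apply/andP; split; apply/eqP.
Qed.

Definition point u v (uv : vertex u v) : tower := SeqSub (introT (vertexP u v) uv).

Lemma abs_point u v (uv : vertex u v) : abs (point uv) = u. Proof. by []. Qed.

Lemma ord_point u v (uv : vertex u v) : ord (point uv) = v. Proof. by []. Qed.

Definition tower_le (x y : tower) := (abs x <= abs y) && (ord x <= ord y).

Lemma tower_le_refl : reflexive tower_le.
Proof. by move=> x; rewrite /tower_le !leqnn. Qed.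

Lemma tower_le_anti : antisymmetric tower_le.
Proof. by move=> x y h; apply: tower_inj; move: h; rewrite /tower_le; lia. Qed.

Lemma tower_le_trans : transitive tower_le.
Proof. by move=> y x z; rewrite /tower_le; lia. Qed.

HB.instance Definition _ := Order.Le_isPOrder.Build (Order.Disp tt tt) tower
  tower_le_refl tower_le_anti tower_le_trans.

Lemma tower_leE (x y : tower) :
  (x <= y)%O = (abs x <= abs y) && (ord x <= ord y).
Proof. by []. Qed.

(** Reduces the existence of a meet to inequalities between natural numbers, once its coordinates
    are guessed. *)
Lemma glb_ex (x y : tower) u v :
  vertex u v -> u <= abs x -> v <= ord x -> u <= abs y -> v <= ord y ->
  (forall z : tower,
    abs z <= abs x -> ord z <= ord x -> abs z <= abs y -> ord z <= ord y ->
    abs z <= u /\ ord z <= v) ->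
  exists w : tower, forall z, (z <= w)%O = (z <= x)%O && (z <= y)%O.
Proof.
move=> uv ux vx uy vy H; exists (point uv) => z; rewrite !tower_leE abs_point ord_point.
apply/idP/idP; first lia.
by case/andP=> /andP[? ?] /andP[? ?]; apply/andP/H.
Qed.

Lemma tower_glb (x y : tower) :
  exists w : tower, forall z, (z <= w)%O = (z <= x)%O && (z <= y)%O.
Proof.
wlog xy : x y / abs x < abs y.
  move=> H; case: (ltngtP (abs x) (abs y)) => [|/H[w hw]|e]; first exact: H.
    by exists w => z; rewrite hw andbC.
  by case: (leqP (ord x) (ord y)) => ?; [exists x|exists y] => z;
    rewrite !tower_leE; lia.
have [le_v|lt_v] := leqP (ord x) (ord y).
  by exists x => z; rewrite !tower_leE; lia.
(* Now x is to the left of y: the meet is the highest vertex in the quadrant below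
   (abs x, ord y). *)
have [low|] := boolP ((abs x <= m) || (ord y == 0)).
  apply: (glb_ex VBot) => // z; move: low xy lt_v.
  case: (towerP z) => [|||? ?|? ?|? ?|? ?|? ?|? ?]; try lia.
  - by case: (towerP y) => *; lia.
  - by case: (towerP x) => *; lia.
rewrite negb_or -ltnNge -lt0n => /andP[x_gt y_gt].
(* Here [x] is some b_i. The meet is the bottom if [y] is some c_j, and otherwise the highest b_k
   with [3 * k + 2 <= ord y]. *)
have [xE|x_neq] := eqVneq (abs x) (m + 1).
  have [yE|y_neq] := eqVneq (ord y) 1.
    by apply: (glb_ex VBot) => // z; case: (towerP z) => *; lia.
  have [k [kN k_le lt_k]] : exists k,
      [/\ k <= N, 3 * k + 2 <= ord y & ord y <= 3 * k + 4].
    exists ((ord y - 2) %/ 3); split; try lia.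
    move: xE y_neq lt_v xy y_gt.
    by case: (towerP y); case: (towerP x) => *; lia.
  (* Since [ord y < ord x], this bound keeps the left atoms from being common lower bounds. *)
  have vx : ord x <= 3 * N + 2 by move: xE; case: (towerP x) => *; lia.
  apply: (glb_ex (VB kN)) => //; try lia.
  by move=> z; case: (towerP z) => *; lia.
(* Mirror case: [y] is some c_j, and the meet is the last c_k with [m + 3 * k + 2 <= abs x]. *)
have [yE|y_neq] := eqVneq (ord y) 1.
  have [k [kN k_le lt_k]] : exists k,
      [/\ k <= N, m + 3 * k + 2 <= abs x & abs x <= m + 3 * k + 4].
    exists ((abs x - m - 2) %/ 3); split; try lia.
    move: yE x_neq x_gt lt_v xy.
    by case: (towerP x); case: (towerP y) => *; lia.
  have uy : abs y <= m + 3 * N + 2 by move: yE; case: (towerP y) => *; lia.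
  apply: (glb_ex (VC kN)) => //; try lia.
  by move=> z; case: (towerP z) => *; lia.
(* Among the remaining F, G and H only F_k and G_k with equal index are incomparable; for k > 0
   their meet is H_k. *)
have [k kN [ux vx uy vy]] : exists2 k, k <= N &
    [/\ abs x = m + 3 * k + 1, ord x = 3 * k + 2,
        abs y = m + 3 * k + 2 & ord y = 3 * k + 1].
  move: x_gt y_gt x_neq y_neq xy lt_v.
  case: (towerP x) => [|||i ?|i ?|i ?|i ?|i ?|i ?];
    case: (towerP y) => [|||? ?|? ?|? ?|? ?|? ?|? ?]; try lia.
  by exists i; [lia|split; lia].
have [k0|k_gt0] := posnP k.
  by apply: (glb_ex VBot) => // z; case: (towerP z) => *; lia.
have kN' : 0 < k <= N by rewrite k_gt0.
apply: (glb_ex (VH kN')) => //; try lia.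
by move=> z; case: (towerP z) => *; lia.
Qed.

Lemma tower_meet_subproof (x y : tower) :
  exists w : tower, [forall z : tower, (z <= w)%O == (z <= x)%O && (z <= y)%O].
Proof. by have [w ?] := tower_glb x y; exists w; apply/forallP => z; apply/eqP. Qed.

Definition tower_meet x y := xchoose (tower_meet_subproof x y).

Lemma tower_lexI x y z : (x <= tower_meet y z)%O = (x <= y)%O && (x <= z)%O.
Proof. by have /forallP/(_ x)/eqP := xchooseP (tower_meet_subproof y z). Qed.

Lemma tower_le0x x : (point VBot <= x)%O.
Proof. by []. Qed.

Lemma tower_lex1 x : (x <= point VTop)%O.
Proof. by rewrite tower_leE abs_point ord_point; case: (towerP x) => *; lia. Qed.

HB.instance Definition _ := Order.hasBottom.Build _ tower tower_le0x.
HB.instance Definition _ := Order.hasTop.Build _ tower tower_lex1.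
HB.instance Definition _ :=
  Order.POrder_isMeetSemilattice.Build _ tower tower_lexI.

(** A finite meet-semilattice with a top has joins: the meet of all common upper bounds. *)
Definition tower_join (x y : tower) : tower :=
  (\meet_(z : tower | (x <= z) && (y <= z)) z)%O.

Lemma tower_leUx x y z : (tower_join x y <= z)%O = (x <= z)%O && (y <= z)%O.
Proof.
apply/idP/idP => [|xyz]; last exact: meets_inf.
by move=> le_z; apply/andP; split; apply: le_trans le_z; apply/meetsP => w /andP[].
Qed.

HB.instance Definition _ :=
  Order.POrder_isJoinSemilattice.Build _ tower tower_leUx.

(** * Generation by the atoms *)

Section Generation.
Variable S : {set tower}.
Hypothesis closed : meet_join_closed S.

(** Phrased by coordinates, so that membership can be rewritten along arithmetic identities without
    carrying a proof of [vertex u v]. *)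
Let contains u v := forall x : tower, abs x = u -> ord x = v -> x \in S.

Lemma contains_join u1 v1 u2 v2 u v :
  vertex u1 v1 -> vertex u2 v2 -> contains u1 v1 -> contains u2 v2 ->
  [&& u1 <= u, v1 <= v, u2 <= u & v2 <= v] ->
  (forall a b, vertex a b -> u1 <= a -> v1 <= b -> u2 <= a -> v2 <= b ->
    u <= a /\ v <= b) ->
  contains u v.
Proof.
move=> h1 h2 in1 in2 ub least x xu xv.
have -> : x = (point h1 `|` point h2)%O.
  apply/le_anti; rewrite leUx !tower_leE xu xv /=; apply/andP; split; last first.
    by move: ub; rewrite !abs_point !ord_point; lia.
  have := lexx (point h1 `|` point h2)%O.
  rewrite leUx !tower_leE => /andP[/andP[? ?] /andP[? ?]].
  by apply/andP/least => //; apply: towerP.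
move/forall_inP: closed => /(_ _ (in1 (point h1) erefl erefl)).
by move=> /forall_inP/(_ _ (in2 (point h2) erefl erefl))/andP[].
Qed.

Lemma contains_meet u1 v1 u2 v2 u v :
  vertex u1 v1 -> vertex u2 v2 -> contains u1 v1 -> contains u2 v2 ->
  [&& u <= u1, v <= v1, u <= u2 & v <= v2] ->
  (forall a b, vertex a b -> a <= u1 -> b <= v1 -> a <= u2 -> b <= v2 ->
    a <= u /\ b <= v) ->
  contains u v.
Proof.
move=> h1 h2 in1 in2 ub least x xu xv.
have -> : x = (point h1 `&` point h2)%O.
  apply/le_anti; rewrite lexI !tower_leE xu xv /=; apply/andP; split.
    by move: ub; rewrite !abs_point !ord_point; lia.
  have := lexx (point h1 `&` point h2)%O.
  rewrite lexI !tower_leE => /andP[/andP[? ?] /andP[? ?]].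
  by apply/andP/least => //; apply: towerP.
move/forall_inP: closed => /(_ _ (in1 (point h1) erefl erefl)).
by move=> /forall_inP/(_ _ (in2 (point h2) erefl erefl))/andP[].
Qed.

Hypothesis N_gt0 : 0 < N.
Hypothesis left_atoms : forall j, j <= m -> contains j (m + 3 * N + 2 - j).
Hypothesis right_atom : contains (m + 3 * N + 2) 0.
Hypothesis b_atom : contains (m + 1) 2.
Hypothesis c_atom : contains (m + 2) 1.

Let Vb : vertex (m + 1) 2. Proof. exact: (@VB 0). Qed.
Let Vc : vertex (m + 2) 1. Proof. by have := @VC 0 isT; rewrite addn0. Qed.

Let contains_chains_top : contains (m + 1) (3 * N + 2) /\ contains (m + 3 * N + 2) 1.
Proof.
split.
  apply: (contains_join (VLeftAtom (leqnn m)) Vb (left_atoms (leqnn m)) b_atom);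
    first lia.
  by move=> a b []*; lia.
apply: (contains_join VRightAtom Vc right_atom c_atom); first lia.
by move=> a b []*; lia.
Qed.

Let contains_F k : 0 < k <= N -> contains (m + 1) (3 * k + 2) ->
  contains (m + 3 * k + 1) (3 * k + 2).
Proof.
case/andP=> k0 kN inb; apply: (contains_join (VB kN) Vc inb c_atom); first lia.
by move=> a b []*; lia.
Qed.

Let contains_G k : 0 < k <= N -> contains (m + 3 * k + 2) 1 ->
  contains (m + 3 * k + 2) (3 * k + 1).
Proof.
case/andP=> k0 kN inc; apply: (contains_join (VC kN) Vb inc b_atom); first lia.
by move=> a b []*; lia.
Qed.

Let contains_chains k : k <= N ->
  contains (m + 1) (3 * k + 2) /\ contains (m + 3 * k + 2) 1.
Proof.
have [topB topC] := contains_chains_top.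
(* Descending induction on [k], run as induction on [N - k]: the chains are recovered from their
   tops downwards. *)
move: {-1}(N - k) (erefl (N - k)) => i.
elim: i k => [|i IH] k e kN.
  by have -> : k = N by lia.
have kN' : k.+1 <= N by lia.
have [inB inC] : contains (m + 1) (3 * k.+1 + 2) /\ contains (m + 3 * k.+1 + 2) 1.
  by apply: IH => //; lia.
split.
  apply: (contains_meet (VG kN') (VB (leqnn N)) (contains_G _ inC) topB) => //;
    first lia.
  by move=> a b []*; lia.
apply: (contains_meet (VF kN') (VC (leqnn N)) (contains_F _ inB) topC) => //;
  first lia.
by move=> a b []*; lia.
Qed.

Lemma contains_all (x : tower) : x \in S.
Proof.
suff: contains (abs x) (ord x) by move=> /(_ x erefl erefl).
case: (towerP x) => [||//|j /left_atoms//|k /contains_chains[]//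
  |k /contains_chains[]//|k kN|k kN|k kN].
(* The bottom is the meet of the atoms d and a_0. *)
- apply: (contains_meet VRightAtom (VLeftAtom (leqnn m)) right_atom
    (left_atoms (leqnn m))); first lia.
  by move=> a b []*; lia.
(* The top plays the part of H_(N+1), as the join of b_N and c_N. *)
- have [inB inC] := contains_chains (leqnn N).
  apply: (contains_join (VB (leqnn N)) (VC (leqnn N)) inB inC); first lia.
  by move=> a b []*; lia.
- have [inB inC] := contains_chains kN.
  by case: (posnP k) => [->|k0]; [rewrite muln0 addn0|apply: contains_F; rewrite ?k0].
- have [inB inC] := contains_chains kN.
  by case: (posnP k) => [->|k0]; [rewrite muln0 addn0|apply: contains_G; rewrite ?k0].
- have k1N : k.-1 <= N by lia.
  have [inB inC] := contains_chains k1N.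
  apply: (contains_join (VB k1N) (VC k1N) inB inC); first lia.
  by move=> a b []*; lia.
Qed.
End Generation.

(** * The atoms of the tower and its size *)

Definition atom_abs i := if i <= m + 2 then i else m + 3 * N + 2.
Definition atom_ord i :=
  if i <= m then m + 3 * N + 2 - i else m + 3 - i.

Lemma vertex_atom i : i < m + 4 -> vertex (atom_abs i) (atom_ord i).
Proof.
rewrite /atom_abs /atom_ord => i_lt.
have [im|mi] := leqP i m.
  by rewrite (leq_trans im) ?leq_addr //; apply: VLeftAtom.
have [e|[e|e]] : i = m + 1 \/ i = m + 2 \/ i = m + 3 by lia.
- rewrite e; have -> : (m + 1 <= m + 2) by lia.
  have -> : m + 3 - (m + 1) = 3 * 0 + 2 by lia.
  exact: VB.
- rewrite e leqnn; have -> : m + 3 - (m + 2) = 1 by lia.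
  have -> : m + 2 = m + 3 * 0 + 2 by lia.
  exact: VC.
- rewrite e; have -> : (m + 3 <= m + 2) = false by lia.
  by rewrite subnn; apply: VRightAtom.
Qed.

(** The atoms are numbered from left to right: indices up to [m] give a_m, ..., a_0, and the last
    three give b_0, c_0, d. *)
Definition atom (i : 'I_(m + 4)) : tower := point (vertex_atom (ltn_ord i)).

(** For [N = 0] the element a_0 = (m, 2) would lie below b_0 = (m + 1, 2), which would then not be
    an atom. *)
Hypothesis N_gt0 : 0 < N.

Lemma atom_inj : injective atom.
Proof.
move=> i j /(congr1 abs); rewrite !abs_point /atom_abs => e; apply: ord_inj.
have := ltn_ord i; have := ltn_ord j; move: e N_gt0.
case: ifP => ?; case: ifP => ?; lia.
Qed.

Lemma atom_covers i : covers \bot%O (atom i).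
Proof.
have atom_min z : (z <= atom i)%O -> z = \bot%O \/ z = atom i.
  rewrite tower_leE abs_point ord_point => le_z.
  suff: abs z = 0 /\ ord z = 0 \/ abs z = atom_abs i /\ ord z = atom_ord i.
    by case=> -[? ?]; [left|right]; apply: tower_inj.
  move: le_z; rewrite /atom_abs /atom_ord.
  by case: ifP => ?; case: ifP => ?; case: (towerP z) => *; lia.
apply/andP; split.
  rewrite lt_neqAle le0x andbT; apply/eqP => e.
  have := congr1 abs e; have := congr1 ord e.
  rewrite abs_point ord_point [abs _]abs_point [ord _]ord_point /atom_abs /atom_ord.
  by case: ifP => ?; case: ifP => ?; lia.
apply/forallP => z; apply/negP => /andP[bz zi].
by case: (atom_min z (ltW zi)) => e; move: bz zi; rewrite e ltxx.
Qed.

Lemma atom_below (x : tower) : x != \bot%O -> exists i, (atom i <= x)%O.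
Proof.
move=> x_neq; suff [i i_lt le_i] : exists2 i, i < m + 4 &
    (atom_abs i <= abs x) && (atom_ord i <= ord x).
  by exists (Ordinal i_lt); rewrite tower_leE.
have {x_neq} pos_x : 0 < abs x + ord x.
  rewrite lt0n; apply: contra x_neq; rewrite addn_eq0 => /andP[/eqP ? /eqP ?].
  by apply/eqP/tower_inj.
(* In the first [m + 1] columns [x] is itself a left atom. Further right, [ord x] equal to 0, equal
   to 1, or at least 2 selects d, c_0 or b_0. *)
have [x_le|x_gt] := leqP (abs x) m; [exists (abs x)|exists (m + 3 - minn (ord x) 2)].
- by lia.
- rewrite /atom_abs /atom_ord; move: x_le pos_x.
  by case: (towerP x) => *; repeat case: ifP => ?; lia.
- by lia.
- rewrite /atom_abs /atom_ord; move: x_gt pos_x.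
  by case: (towerP x) => *; repeat case: ifP => ?; lia.
Qed.

Lemma atoms_tower : atoms tower = [set atom i | i : 'I_(m + 4)].
Proof.
apply/setP => x; rewrite inE; apply/idP/imsetP => [x_atom|[i _ ->]]; last first.
  exact: atom_covers.
have := covers_lt x_atom; rewrite lt_neqAle eq_sym => /andP[/atom_below[i ix] _].
exists i => //; have /(covers_between x_atom)[e|//] : (\bot <= atom i <= x)%O.
  by rewrite le0x.
by have := covers_lt (atom_covers i); rewrite e ltxx.
Qed.

Lemma tower_generated : generated (atoms tower) = [set: tower].
Proof.
apply/eqP; rewrite -subTset; apply/bigcapsP => S /andP[/subsetP atomsS closed].
have contains_atom i u v : i < m + 4 -> atom_abs i = u -> atom_ord i = v ->
    forall y, abs y = u -> ord y = v -> y \in S.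
  move=> i_lt <- <- y yu yv; apply: atomsS; rewrite atoms_tower; apply/imsetP.
  by exists (Ordinal i_lt) => //; apply: tower_inj.
apply/subsetP => x _; apply: contains_all => // [j jm|||].
- by apply: (contains_atom j); rewrite /atom_abs /atom_ord;
    repeat case: ifP => ?; lia.
- by apply: (contains_atom (m + 3)); rewrite /atom_abs /atom_ord;
    repeat case: ifP => ?; lia.
- by apply: (contains_atom (m + 1)); rewrite /atom_abs /atom_ord;
    repeat case: ifP => ?; lia.
- by apply: (contains_atom (m + 2)); rewrite /atom_abs /atom_ord;
    repeat case: ifP => ?; lia.
Qed.

(** The chain b_0, ..., b_N alone has [N + 1] elements. *)
Lemma card_tower : N < #|{: tower}|.
Proof.
have f_inj : injective (fun k : 'I_N.+1 => point (VB (ltn_ord k : k <= N))).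
  by move=> j k /(congr1 ord); rewrite !ord_point => e; apply: ord_inj; lia.
by have := leq_card _ f_inj; rewrite !card_ord.
Qed.
End Tower.

Theorem theorem2 (R : realType) (k n : nat) (hk : 1 < k) (hn : 3 < n) :
  exists (d : Order.disp_t) (L : finTBLatticeType d),
    [/\ planar R L,
        #|atoms L| = n /\ generated (atoms L) = [set: L] &
        k < #|{: L}|].
Proof.
have k_gt0 : 0 < k by exact: ltnW.
(* With [m = n - 4] there are [m + 4 = n] atoms, and height [k] already forces more than [k]
   elements. *)
exists _, (tower (n - 4) k); split; last exact: card_tower.
  apply: (@planar_of_embedding R _ _ (fun x => (abs x)%:R%R) (fun x => (ord x)%:R%R)).
  by move=> x y; rewrite !ler_nat.
split; last exact: tower_generated.
by rewrite atoms_tower // card_imset ?card_ord ?subnK //; apply: atom_inj.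
Qed.
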